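(* Let $R$ be a ring and let $e\in R$ be a nonzero idempotent. If $R$ is right $e$-reversible, then $R$ is right $e$-semicommutative.
   Context: All rings are associative with identity. For a nonzero idempotent $e\in R$: $R$ is right $e$-reversible if for all $a,b\in R$, $ab=0$ implies $bae=0$; $R$ is right $e$-semicommutative if for all $a,b\in R$, $ab=0$ implies $aRbe=0$. *)

(* Defs.v *)
From mathcomp Require Import all_boot all_algebra.

Set Implicit Arguments.
Unset Strict Implicit.
Unset Printing Implicit Defensive.

Import GRing.Theory.
Local Open Scope ring_scope.

(* The two notions below are meant for a nonzero idempotent [e]; that
   assumption is left to the statements that use them. *)
Definition right_e_reversible (R : pzRingType) (e : R) : Prop :=
  forall a b : R, a * b = 0 -> b * a * e = 0.

(* [aRbe = 0] is read elementwise: [a * r * b * e = 0] for all [r] in [R]. *)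
Definition right_e_semicommutative (R : pzRingType) (e : R) : Prop :=
  forall a b : R, a * b = 0 -> forall r : R, a * r * b * e = 0.

(* Main.v *)
(** Applied to [e * ((1 - e) * x) = 0], right e-reversibility gives
    [x e = e x e] for all [x]. If [a b = 0], then [b (a e r) = 0], so
    [a e r b e = 0], and the identity above moves the inner [e] past [r]
    to absorb it into [b e]. *)
Require Import Defs.
From mathcomp Require Import all_boot all_algebra.

Import GRing.Theory.
Local Open Scope ring_scope.

(** The conclusion says that [e] is left semicentral, i.e. [(1 - e) * x * e = 0] for every [x]. *)
Lemma right_e_reversible_semicentral (R : pzRingType) (e : R) :
  e * e = e -> right_e_reversible e -> forall x : R, x * e = e * x * e.
Proof.
move=> ee rev x.
have /rev : e * ((1 - e) * x) = 0 by rewrite mulrA mulrBr mulr1 ee subrr mul0r.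
by rewrite -mulrA ee mulrBl mul1r mulrBl => /subr0_eq.
Qed.

Theorem proposition2p11 (R : pzRingType) (e : R) (he0 : e <> 0)
    (hidem : e * e = e) :
  right_e_reversible e -> right_e_semicommutative e.
Proof.
move=> rev a b ab0 r.
have semi := right_e_reversible_semicentral _ _ hidem rev.
(* Reversibility acts twice: on [a * b = 0], giving [b * a * e = 0] and hence this product, then
   through the view, giving [a * e * r * b * e = 0]. *)
have /rev aerbe0 : b * (a * e * r) = 0 by rewrite !mulrA rev ?mul0r.
rewrite -[RHS]aerbe0 -!mulrA; congr (a * _).
(* [semi] is used at [x := r * b], so that [e] may be inserted on the left of [r * b * e]. *)
by rewrite [LHS]mulrA semi !mulrA.
Qed.
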